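(* Let $n_1,n_2, \ldots, n_l \geq 1$ be integers, let $F_1, F_2, \ldots, F_l$ be finite fields of cardinalities $q_1, q_2, \ldots, q_l$ respectively, and let $R=M_{n_1}(F_1) \times M_{n_2}(F_2) \times \cdots \times M_{n_l}(F_l)$. Then $$\begin{aligned}W(\Gamma(R))={}&|Z(R)|^2 - \frac{5}{2}|Z(R)|+\frac{3}{2} + \left( \frac{T(R)}{2} - 2^{l-1} +1 \right)\prod_{i=1}^l\left(q_i^{\binom{n_i}{2}}\prod_{j=1}^{n_i}(q_i^{j}-1)\right)\\ &- \frac{1}{2}\sum_{k_1=0}^{n_1}\cdots\sum_{k_l=0}^{n_l}\left[\prod_{i=1}^l\left(\prod_{j=0}^{k_i-1}\frac{(q_i^{n_i}-q_i^{j})^2}{q_i^{k_i}-q_i^{j}}\right)\cdot\left(\prod_{i=1}^l q_i^{(n_i-k_i)^2}\right)\cdot\left(2\prod_{i=1}^l q_i^{k_i(n_i-k_i)}-1\right)\right]\\ &+\frac{1}{2}\prod_{i=1}^l q_i^{n_i^2} + \frac{1}{2}\prod_{i=1}^l\prod_{j=0}^{n_i-1}(q_i^{n_i}-q_i^{j}) + \frac{1}{2}|N_2(R)|,\end{aligned}$$ where the following equations hold: $$|Z(R)|=\prod_{i=1}^l q_i^{n_i^2}-\prod_{i=1}^l\left(q_i^{\binom{n_i}{2}}\prod_{j=1}^{n_i}(q_i^{j}-1)\right),$$ $$|N_2(R)|=\sum_{k_1=0}^{n_1-1}\cdots\sum_{k_l=0}^{n_l-1}\ \prod_{i=1}^l\left(\frac{\prod_{j=0}^{2k_i-1}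 \left( q_i^{n_i}- q_i^{j}\right)}{q_i^{k_i^2}\prod_{j=0}^{k_i-1}\left( q_i^{k_i}-q_i^{j} \right)}\right) - 1,$$ $$T(R)=\sum_{\Lambda \subseteq \{1,2,\ldots,l\},\ |\Lambda| \geq 2}(2^{|\Lambda|}-2)\prod_{i=1}^l \omega_i,$$ where, for each $\Lambda$, $\omega_i=q_i^{n_i^2}-q_i^{\binom{n_i}{2}}\prod_{j=1}^{n_i}(q_i^{j}-1)$ if $i \in \Lambda$ and $\omega_i=q_i^{\binom{n_i}{2}}\prod_{j=1}^{n_i}(q_i^{j}-1)$ otherwise.
   Context: $M_n(F)$ is the ring of all $n\times n$ matrices with entries in $F$. For a finite ring $R$ (possibly non-commutative), $Z(R)=\{x \in R : \text{there exists } 0 \neq y \in R \text{ such that } xy=0 \text{ or } yx=0\}$ is the set of zero-divisors (so $0\in Z(R)$ for $R\neq 0$), and $N_2(R)=\{0\neq A\in R : A^2=0\}$. The zero-divisor graph $\Gamma(R)$ is the undirected simple graph with vertex set $V(\Gamma(R))=Z(R)\setminus\{0\}$ in which two distinct vertices $x \neq y$ are joined by an edge if and only if $xy=0$ or $yx=0$. $d(u,v)$ denotes the distance (length of a shortest path) between vertices $u$ and $v$. The Wiener index of a graph $\Gamma$ is $W(\Gamma)=\frac12\sum_{u,v\in V(\Gamma)}d(u,v)$, the sum being over ordered pairs. Empty products equal $1$ and empty sums equal $0$. *)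

(* Defs.v *)
From HB Require Import structures.
From mathcomp Require Import all_boot all_order all_algebra.

Set Implicit Arguments.
Unset Strict Implicit.
Unset Printing Implicit Defensive.

Import Order.TTheory GRing.Theory.
Local Open Scope ring_scope.

Definition prod_ring (I : finType) (R : I -> finPzRingType) :=
  {dffun forall i, R i}.

Section ProdRing.
Variables (I : finType) (R : I -> finPzRingType).
Implicit Types x y z : prod_ring R.

HB.instance Definition _ := Finite.on (prod_ring R).

Definition prod_zero : prod_ring R := [ffun i => 0].
Definition prod_opp x : prod_ring R := [ffun i => - x i].
Definition prod_add x y : prod_ring R := [ffun i => x i + y i].
Definition prod_one : prod_ring R := [ffun i => 1].
Definition prod_mul x y : prod_ring R := [ffun i => x i * y i].

Fact prod_addA : associative prod_add.
Proof. by move=> x y z; apply/ffunP=> i; rewrite !ffunE addrA. Qed.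
Fact prod_addC : commutative prod_add.
Proof. by move=> x y; apply/ffunP=> i; rewrite !ffunE addrC. Qed.
Fact prod_add0 : left_id prod_zero prod_add.
Proof. by move=> x; apply/ffunP=> i; rewrite !ffunE add0r. Qed.
Fact prod_addN : left_inverse prod_zero prod_opp prod_add.
Proof. by move=> x; apply/ffunP=> i; rewrite !ffunE addNr. Qed.

HB.instance Definition _ := GRing.isZmodule.Build (prod_ring R)
  prod_addA prod_addC prod_add0 prod_addN.

Fact prod_mulA : associative prod_mul.
Proof. by move=> x y z; apply/ffunP=> i; rewrite !ffunE mulrA. Qed.
Fact prod_mul1l : left_id prod_one prod_mul.
Proof. by move=> x; apply/ffunP=> i; rewrite !ffunE mul1r. Qed.
Fact prod_mul1r : right_id prod_one prod_mul.
Proof. by move=> x; apply/ffunP=> i; rewrite !ffunE mulr1. Qed.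
Fact prod_mulDl : left_distributive prod_mul +%R.
Proof. by move=> x y z; apply/ffunP=> i; rewrite !ffunE mulrDl. Qed.
Fact prod_mulDr : right_distributive prod_mul +%R.
Proof. by move=> x y z; apply/ffunP=> i; rewrite !ffunE mulrDr. Qed.

HB.instance Definition _ := GRing.Zmodule_isPzRing.Build (prod_ring R)
  prod_mulA prod_mul1l prod_mul1r prod_mulDl prod_mulDr.

End ProdRing.

(* For general n the library makes 'M[F]_n a ring and a finite type, but only *)
(* 'M[F]_n.+1 canonically a finite ring.                                      *)
Definition mx_ring (F : finFieldType) (n : nat) : finPzRingType :=
  HB.pack 'M[F]_n (Finite.on 'M[F]_n) (GRing.PzRing.on 'M[F]_n).

Definition mx_prod_ring (l : nat) (n : 'I_l -> nat) (F : 'I_l -> finFieldType) :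
  finPzRingType := prod_ring (fun i => mx_ring (F i) (n i)).

Section SimpleGraph.
Variables (V : finType) (e : rel V).

Definition has_walk (u v : V) (k : nat) : bool :=
  [exists p : k.-tuple V, path e u p && (last u p == v)].

(* A shortest path has fewer than #|V| edges, so the value #|V| is taken      *)
(* exactly when u and v lie in different components (see dist_connect).       *)
Definition dist (u v : V) : nat :=
  \big[Order.min/#|V|]_(k < #|V| | has_walk u v k) (k : nat).

(* The sum is over ordered pairs of vertices. *)
Definition wiener_index : rat := 2^-1 * \sum_(u : V) \sum_(v : V) (dist u v)%:R.

Lemma uniq_path_size (u : V) (p : seq V) : uniq (u :: p) -> (size p < #|V|)%N.
Proof.
by move=> up; rewrite (leq_trans _ (max_card (mem (u :: p)))) ?(card_uniqP up).
Qed.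

Lemma dist_le (u : V) (p : seq V) :
  path e u p -> (dist u (last u p) <= size p)%N.
Proof.
move=> up; case/shortenP: up => p' up' uniq_p' sub_p'.
have lt_p' := uniq_path_size uniq_p'.
have le_p' : (size p' <= size p)%N.
  by apply: uniq_leq_size sub_p'; case/andP: uniq_p'.
apply: leq_trans le_p'; rewrite -leEnat.
apply: (bigmin_le_cond _ (j := Ordinal lt_p')).
by apply/existsP; exists (in_tuple p'); rewrite up' /=.
Qed.

Lemma dist_connect (u v : V) : (dist u v < #|V|)%N = connect e u v.
Proof.
apply/idP/connectP=> [lt_d | [p up ->]]; last first.
  case/shortenP: up => p' up' uniq_p' _.
  by apply: leq_ltn_trans (dist_le up') (uniq_path_size uniq_p').
case: (pickP (fun k : 'I_#|V| => has_walk u v k)) => [k | no_walk].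
  by case/existsP=> p /andP[up /eqP <-]; exists p.
by move: lt_d; rewrite /dist big_pred0 // ltnn.
Qed.

Lemma dist_attained (u v : V) :
  connect e u v -> exists2 p, path e u p & last u p = v /\ size p = dist u v.
Proof.
rewrite -dist_connect => lt_d.
case: (pickP (fun k : 'I_#|V| => has_walk u v k)) => [k k_walk | no_walk].
  have [|j j_walk] := @eq_bigmin _ _ _ #|V| k (fun k => has_walk u v k)
    (fun k => nat_of_ord k) k_walk.
    by move=> i _; rewrite leEnat ltnW.
  rewrite -/(dist u v) => ->; case/existsP: j_walk => p /andP[up /eqP <-].
  by exists p; rewrite ?size_tuple.
by move: lt_d; rewrite /dist big_pred0 // ltnn.
Qed.

End SimpleGraph.

Section ZeroDivisorGraph.
Variable R : finPzRingType.

Definition zero_divisors : {set R} :=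
  [set x | [exists y : R, (y != 0) && ((x * y == 0) || (y * x == 0))]].

Definition square_zero : {set R} := [set A : R | (A != 0) && (A ^+ 2 == 0)].

Definition zd_vertex : finType := {x : R | x \in zero_divisors :\ 0}.

Definition zd_edge : rel zd_vertex :=
  [rel x y | (x != y) && ((val x * val y == 0) || (val y * val x == 0))].

End ZeroDivisorGraph.

(* The order of GL_n over the field with q elements. *)
Definition gl_prod (q n : nat) : rat :=
  q%:R ^+ 'C(n, 2) * \prod_(1 <= j < n.+1) (q%:R ^+ j - 1).

Definition T_sum (l : nat) (n q : 'I_l -> nat) : rat :=
  \sum_(L : {set 'I_l} | (2 <= #|L|)%N)
    (2 ^+ #|L| - 2) *
    \prod_(i < l) (if i \in L then (q i)%:R ^+ (n i ^ 2) - gl_prod (q i) (n i)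
                   else gl_prod (q i) (n i)).

(* Main.v *)
(* The product of the matrix rings enters only through zero-divisors being
   componentwise: two of them have a common neighbour exactly when they are
   both singular in some component, since a column of the right kernel of a
   times a row of the left kernel of b is annihilated by a on the left and by b
   on the right. Otherwise they are adjacent or at distance 3. Hence twice the
   Wiener index is twice the number of ordered pairs of distinct vertices, minus
   the number of adjacent ones, plus the number of non-adjacent pairs with
   disjoint singular supports. All three are sums over pairs in R x R of
   products of componentwise indicators, so they factor over the components.
   Matrices of rank k are counted as pairs (C, B) of full-rank n x k and k x n
   matrices modulo GL_k; C B squares to 0 exactly when B C = 0. *)
Require Import Defs.
From HB Require Import structures.
From mathcomp Require Import all_boot all_order all_algebra.
From mathcomp Require Import ring lra.
Import Order.TTheory GRing.Theory Num.Theory.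
Set Implicit Arguments.
Unset Strict Implicit.
Unset Printing Implicit Defensive.
Local Open Scope ring_scope.

Lemma card_set_sum (T : finType) (P : pred T) :
  #|[set x | P x]|%:R = \sum_x (P x)%:R :> rat.
Proof.
rewrite -sum1dep_card natr_sum big_mkcond /=; apply: eq_bigr => x _.
by case: (P x).
Qed.

(** * Counting matrices over a finite field by rank and by annihilators *)

Section MatrixCounts.
Variable F : finFieldType.
Let q : rat := #|F|%:R.

Lemma q_gt1 : 1 < q.
Proof. by rewrite /q ltr1n card_finNzRing_gt1. Qed.

(** Coordinates in a basis of the row space of [U] parametrise these [X], uniquely because the basis
    is free. *)
Lemma card_submx k m n (U : 'M[F]_(m, n)) :
  #|[set X : 'M[F]_(k, n) | (X <= U)%MS]|%:R = q ^+ (k * \rank U).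
Proof.
suff -> : [set X : 'M[F]_(k, n) | (X <= U)%MS]
          = [set Y *m row_base U | Y : 'M[F]_(k, \rank U)].
  by rewrite card_imset ?card_mx ?natrX //; apply: row_free_inj (row_base_free U).
apply/setP=> X; rewrite inE -(eq_row_base U); apply/submxP/imsetP.
  by case=> Y ->; exists Y.
by case=> Y _ ->; exists Y.
Qed.

Lemma row_free_col_mx k n (v : 'rV[F]_n) (X : 'M_(k, n)) :
  row_free (col_mx v X) = row_free X && ~~ (v <= X)%MS.
Proof.
rewrite -!row_leq_rank -addsmxE addsmxC.
have [vX|nvX] := boolP (v <= X)%MS.
  rewrite andbF (addsmx_idPl vX); apply/negbTE; rewrite -ltnNge.
  exact: rank_leq_row.
rewrite andbT; apply/idP/idP => [|freeX].
  move=> /leq_trans/(_ (mxrank_adds_leqif _ _)) => h.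
  have := leq_trans h (leq_add (leqnn _) (rank_leq_row v)).
  by rewrite addnC leq_add2r.
apply: leq_ltn_trans freeX _.
have [le_r eq_r] := mxrank_leqif_sup (addsmxSl X v).
rewrite ltn_neqAle le_r andbT eq_r addsmx_sub submx_refl /=.
exact: nvX.
Qed.

(** Induction on the rows: a new row may be any vector of [U] outside the span of the [k]
    independent rows already chosen. When [k] exceeds [\rank U], the factor [j = \rank U] vanishes,
    as it should. *)
Lemma card_row_free_sub k m n (U : 'M[F]_(m, n)) :
  #|[set X : 'M[F]_(k, n) | row_free X && (X <= U)%MS]|%:R
    = \prod_(0 <= j < k) (q ^+ \rank U - q ^+ j).
Proof.
elim: k => [|k IHk].
  rewrite big_nil (_ : [set _ | _] = setT) ?cardsT ?card_mx ?mul0n //.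
  by apply/setP=> X; rewrite !inE flatmx0 /row_free mxrank0 eqxx sub0mx.
rewrite big_nat_recr //= -IHk !card_set_sum.
rewrite (reindex (fun p : 'rV[F]_n * 'M[F]_(k, n) => col_mx p.1 p.2)) /=; last first.
  exists (fun Y : 'M[F]_(1 + k, n) => (usubmx Y, dsubmx Y)) => /=.
    by move=> [v X] _ /=; rewrite col_mxKu col_mxKd.
  by move=> Y _; rewrite vsubmxK.
rewrite -(pair_bigA _ (fun v X => (row_free (col_mx v X) && (col_mx v X <= U)%MS)%:R)).
rewrite exchange_big mulr_suml /=; apply: eq_bigr => X _.
under eq_bigr => v _ do rewrite row_free_col_mx -addsmxE addsmx_sub.
have [freeX /=|] := boolP (row_free X); last first.
  by move=> _; rewrite mul0r big1.
have [XU|] := boolP (X <= U)%MS; last first.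
  by move=> _; rewrite mul0r big1 // => v _; rewrite !andbF.
(* Both powers of [q] become cardinalities of sets of row vectors, so the difference can be compared
   one [v] at a time. *)
rewrite mul1r -[k in RHS](eqP freeX) -[\rank U in RHS]mul1n -[\rank X in RHS]mul1n.
rewrite -!card_submx !card_set_sum -sumrB; apply: eq_bigr => v _.
rewrite andbT; have [vX|] /= := boolP (v <= X)%MS.
  by rewrite (submx_trans vX XU) subrr.
by rewrite subr0.
Qed.

(** The general linear group of size [\rank A] acts simply transitively on the factorizations of
    [A]: each one is [f g] for exactly one invertible [g]. *)
Lemma card_rank_factorization m n (A : 'M[F]_(m, n)) :
  #|[set CB : 'M[F]_(m, \rank A) * 'M[F]_(\rank A, n) | CB.1 *m CB.2 == A]|%:R
    = \prod_(0 <= j < \rank A) (q ^+ \rank A - q ^+ j).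
Proof.
have := card_row_free_sub (\rank A) (1%:M : 'M[F]_(\rank A)).
rewrite mxrank1 => <-.
pose f (g : 'M[F]_(\rank A)) := (col_base A *m invmx g, g *m row_base A).
suff -> : [set CB : 'M[F]_(m, \rank A) * 'M[F]_(\rank A, n) | CB.1 *m CB.2 == A]
   = [set f g | g in [set g | row_free g && (g <= (1%:M : 'M[F]_(\rank A)))%MS]].
  by rewrite card_imset // => g h [_ /(row_free_inj (row_base_free A))].
apply/setP=> -[C B]; rewrite inE /=; apply/eqP/imsetP => [CBA | [g]]; last first.
  rewrite inE submx1 andbT row_free_unit => Ug [-> ->].
  by rewrite mulmxA mulmxKV // mulmx_base.
(* [B] has only [\rank A] rows and its row space contains that of [A], so the two spaces agree and
   [g] is a change of basis. *)
have sAB : (A <= B)%MS by apply/submxP; exists C.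
have rB : \rank B = \rank A.
  by apply/eqP; rewrite eqn_leq rank_leq_row mxrankS.
have sBA : (B <= row_base A)%MS.
  by rewrite eq_row_base -(mxrank_leqif_sup sAB) rB.
have /submxP[g def_B] := sBA.
have Ug : g \in unitmx.
  by rewrite -row_free_unit -row_leq_rank -{1}rB def_B mxrankM_maxl.
exists g; first by rewrite inE submx1 andbT row_free_unit.
congr (_, _); last exact: def_B.
apply: (row_free_inj (m := m) (A := g)); first by rewrite row_free_unit.
rewrite /= mulmxKV //; apply: (row_free_inj (row_base_free A)).
by rewrite /= mulmx_base -mulmxA -def_B.
Qed.

(** Both sides count the pairs [(C, B)] whose product has rank [k] and satisfies [P]: grouped by
    product on the left, by [B] on the right. A product through dimension [k] has rank [k] exactly
    when both factors have full rank. [P] lets one argument serve the plain rank count and the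
    square-zero count. *)
Lemma card_rank_mul m n k (P : pred 'M[F]_(m, n)) :
  #|[set A | (\rank A == k) && P A]|%:R * \prod_(0 <= j < k) (q ^+ k - q ^+ j)
    = \sum_(B : 'M[F]_(k, n) | row_free B)
        #|[set C : 'M[F]_(m, k) | row_free C^T && P (C *m B)]|%:R.
Proof.
transitivity (\sum_(CB : 'M[F]_(m, k) * 'M[F]_(k, n))
  ((\rank (CB.1 *m CB.2) == k) && P (CB.1 *m CB.2))%:R : rat).
  rewrite card_set_sum mulr_suml.
  rewrite [RHS](partition_big (fun CB => CB.1 *m CB.2) xpredT) //=.
  apply: eq_bigr => A _.
  have -> : \sum_(i : 'M[F]_(m, k) * 'M[F]_(k, n) | i.1 *m i.2 == A)
        ((\rank (i.1 *m i.2) == k) && P (i.1 *m i.2))%:R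
      = ((\rank A == k) && P A)%:R
        * \sum_(i : 'M[F]_(m, k) * 'M[F]_(k, n) | i.1 *m i.2 == A) 1 :> rat.
    by rewrite mulr_sumr; apply: eq_bigr => i /eqP ->; rewrite mulr1.
  have [/= <-|/=] := eqVneq (\rank A) k; last by rewrite !mul0r.
  by rewrite -card_rank_factorization -sum1dep_card natr_sum.
rewrite -(pair_bigA _ (fun C B => ((\rank (C *m B) == k) && P (C *m B))%:R)).
rewrite exchange_big [RHS]big_mkcond /=; apply: eq_bigr => B _.
have [freeB|nfB] := boolP (row_free B); last first.
  apply: big1 => C _; case: eqP => //= rCB; case/negP: nfB.
  by rewrite -row_leq_rank -{1}rCB mxrankM_maxr.
rewrite card_set_sum; apply: eq_bigr => C _.
by rewrite mxrankMfree // /row_free mxrank_tr.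
Qed.

Lemma gl_prod_neq0 k : \prod_(0 <= j < k) (q ^+ k - q ^+ j) != 0.
Proof.
rewrite prodf_seq_neq0; apply/allP=> j; rewrite mem_index_iota /= => jk.
by rewrite subr_eq0 gt_eqF // ltr_eXn2l // q_gt1.
Qed.

Lemma card_rank m n k :
  #|[set A : 'M[F]_(m, n) | \rank A == k]|%:R
    = \prod_(0 <= j < k) ((q ^+ m - q ^+ j) * (q ^+ n - q ^+ j) / (q ^+ k - q ^+ j)).
Proof.
rewrite big_split /= prodfV; apply/(canRL (mulfK (gl_prod_neq0 k))).
have -> : [set A : 'M[F]_(m, n) | \rank A == k]
   = [set A | (\rank A == k) && xpredT A] by apply/setP=> A; rewrite !inE andbT.
rewrite card_rank_mul big_split /=.
have cnt p : #|[set B : 'M[F]_(k, p) | row_free B]|%:R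
   = \prod_(0 <= j < k) (q ^+ p - q ^+ j).
  have := card_row_free_sub k (1%:M : 'M[F]_p); rewrite mxrank1 => <-.
  by congr (_%:R); apply: eq_card => B; rewrite !inE submx1 andbT.
rewrite -(cnt n) [in RHS]card_set_sum big_mkcond mulr_sumr; apply: eq_bigr => B _.
case: (row_free B); last by rewrite mulr0.
rewrite mulr1 -cnt; congr (_%:R).
have -> : [set C : 'M[F]_(m, k) | row_free C^T && true]
  = [set B^T | B in [set B : 'M[F]_(k, m) | row_free B]].
  apply/setP=> C; rewrite inE andbT; apply/idP/imsetP => [fC | [D]].
    by exists C^T; rewrite ?inE ?trmxK.
  by rewrite inE => fD ->; rewrite trmxK.
by rewrite card_imset //; apply: trmx_inj.
Qed.

(** For full-rank factors, [C B C B = 0] cancels to [B C = 0], so the columns of [C] are [k]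
    independent vectors in the kernel of [B], which has dimension [n - k]. *)
Lemma card_rank_square0 n k :
  #|[set A : 'M[F]_n | (\rank A == k) && (A *m A == 0)]|%:R
    = \prod_(0 <= j < 2 * k) (q ^+ n - q ^+ j)
      / (q ^+ (k ^ 2) * \prod_(0 <= j < k) (q ^+ k - q ^+ j)).
Proof.
have q0 : q != 0 by rewrite gt_eqF // (lt_trans ltr01 q_gt1).
rewrite invfM mulrA; apply/(canRL (mulfK (gl_prod_neq0 k))).
apply/(canRL (mulfK (expf_neq0 _ q0))); rewrite card_rank_mul.
have cnt (B : 'M[F]_(k, n)) : row_free B ->
  #|[set C : 'M[F]_(n, k) | row_free C^T && (C *m B *m (C *m B) == 0)]|%:R
   = \prod_(0 <= j < k) (q ^+ (n - k) - q ^+ j) :> rat.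
  move=> fB.
  have -> : (n - k)%N = \rank (kermx B^T).
    by rewrite mxrank_ker mxrank_tr (eqP fB).
  rewrite -card_row_free_sub; congr (_%:R).
  have -> : [set C : 'M[F]_(n, k) | row_free C^T && (C *m B *m (C *m B) == 0)]
    = [set D^T | D in [set D : 'M[F]_(k, n) | row_free D && (D <= kermx B^T)%MS]].
    have eqv (C : 'M[F]_(n, k)) : row_free C^T ->
       (C *m B *m (C *m B) == 0) = (C^T <= kermx B^T)%MS.
      move=> fC; apply/eqP/sub_kermxP => [h|]; last first.
        move=> /(congr1 trmx); rewrite trmx_mul !trmxK trmx0 => h.
        by rewrite !mulmxA -(mulmxA C) h mulmx0 mul0mx.
      rewrite -trmx_mul (_ : B *m C = 0) ?trmx0 //.
      apply: (row_free_inj fB); rewrite /= mul0mx.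
      apply: trmx_inj; apply: (row_free_inj fC).
      by rewrite /= trmx0 mul0mx -trmx_mul !mulmxA -(mulmxA (C *m B)) h trmx0.
    apply/setP=> C; rewrite inE; apply/andP/imsetP => [[fC h] | [D]].
      by exists C^T; rewrite ?trmxK // inE fC -eqv.
    rewrite inE => /andP[fD sD] ->; rewrite eqv ?trmxK //.
  by rewrite card_imset //; apply: trmx_inj.
rewrite (eq_bigr _ cnt).
rewrite sumr_const -mulr_natr.
have -> : #|row_free (F := F) (m := k) (n := n)|%:R
    = \prod_(0 <= j < k) (q ^+ n - q ^+ j) :> rat.
  have := card_row_free_sub k (1%:M : 'M[F]_n); rewrite mxrank1 => <-.
  by congr (_%:R); apply: eq_card => B; rewrite !inE submx1 andbT.
rewrite mul2n -addnn [RHS](@big_cat_nat _ _ _ k) ?leq_addr //=.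
rewrite [RHS]mulrC -mulrA mulrCA [RHS]mulrC.
(* For [k > n] the subtraction [n - k] is truncated, but both sides then contain the zero factor
   [j = n]. *)
have [le_kn|lt_nk] := leqP k n; last first.
  rewrite (_ : \prod_(0 <= j < k) (q ^+ n - q ^+ j) = 0) ?mul0r //.
  by rewrite (@big_cat_nat _ _ _ n.+1) //= big_nat_recr //= subrr mulr0 mul0r.
congr (_ * _); rewrite -[X in _ = \prod_(X <= _ < _) _]add0n big_addn addnK.
(* [q ^+ (k * k)] is spread as one [q ^+ k] per factor, turning [q ^+ (n - k) - q ^+ j] into
   [q ^+ n - q ^+ (j + k)]. *)
rewrite -mulnn exprM mulrC.
rewrite -[in X in _ ^+ X * _](subn0 k) -prodr_const_nat -big_split /=.
by apply: eq_bigr => j _; rewrite mulrBr -!exprD subnKC // addnC.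
Qed.

(** Each of the [n] columns of [B] ranges over the right kernel of [A]; transposition turns columns
    into rows so that [card_submx] applies. *)
Lemma card_rann n (A : 'M[F]_n) :
  #|[set B : 'M[F]_n | A *m B == 0]|%:R = q ^+ (n * (n - \rank A)).
Proof.
have -> : (n - \rank A)%N = \rank (kermx A^T) by rewrite mxrank_ker mxrank_tr.
rewrite -card_submx -(card_imset _ (@trmx_inj _ n n)); congr (_%:R).
apply: eq_card => B; rewrite inE; apply/imsetP/sub_kermxP => [[D] | h].
  by rewrite inE => /eqP h ->; rewrite -trmx_mul h trmx0.
by exists B^T; rewrite ?trmxK // inE -trmx_eq0 trmx_mul trmxK h.
Qed.

(** If the rows of [L] and [K] are bases of the right and left kernels of [A], the two-sided
    annihilators are the products [L^T *m Y *m K], each for a unique [Y], square of size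
    [n - \rank A]. *)
Lemma card_lrann n (A : 'M[F]_n) :
  #|[set B : 'M[F]_n | (A *m B == 0) && (B *m A == 0)]|%:R = q ^+ ((n - \rank A) ^ 2).
Proof.
rewrite (_ : ((n - \rank A) ^ 2)%N = (\rank (kermx A^T) * \rank (kermx A))%N); last first.
  by rewrite !mxrank_ker mxrank_tr mulnn.
pose K := row_base (kermx A); pose L := row_base (kermx A^T).
have KA : K *m A = 0 by apply/sub_kermxP; rewrite eq_row_base.
have LA : L *m A^T = 0 by apply/sub_kermxP; rewrite eq_row_base.
have AL : A *m L^T = 0 by apply: trmx_inj; rewrite trmx_mul trmxK LA trmx0.
have freeK : row_free K := row_base_free _.
have freeL : row_free L := row_base_free _.
have eqK : (K :=: kermx A)%MS := eq_row_base _.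
have eqL : (L :=: kermx A^T)%MS := eq_row_base _.
clearbody K L.
have injL p : injective (mulmx L^T : 'M_(_, p) -> _).
  move=> X Y /(congr1 trmx); rewrite !trmx_mul !trmxK => h.
  by apply: trmx_inj; apply: row_free_inj h.
pose f (Y : 'M_(\rank (kermx A^T), \rank (kermx A))) := L^T *m Y *m K.
rewrite /q -natrX -card_mx -(card_imset (f := f)) /=; last first.
  by move=> X Y /(row_free_inj freeK)/injL.
congr (_%:R); apply: eq_card => B; rewrite inE; apply/idP/imsetP; last first.
  by case=> Y _ ->; rewrite /f !mulmxA AL !mul0mx -(mulmxA _ K) KA mulmx0 eqxx.
case/andP=> /eqP AB /eqP BA.
have /submxP[Y defY] : (B^T <= L)%MS.
  by rewrite eqL; apply/sub_kermxP; rewrite -trmx_mul AB trmx0.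
have defB : B = L^T *m Y^T by rewrite -trmx_mul -defY trmxK.
have /submxP[X defX] : (Y^T <= K)%MS.
  rewrite eqK; apply/sub_kermxP; apply: injL.
  by rewrite mulmxA -defB BA mulmx0.
by exists X => //; rewrite /f -mulmxA -defX.
Qed.

End MatrixCounts.

(** * Sums over families, and general facts on distances and zero-divisors *)

Lemma sum_prod_dffun (I : finType) (T : I -> finType) (f : forall i, T i -> rat) :
  \sum_(x : {dffun forall i, T i}) \prod_i f i (x i) = \prod_i \sum_a f i a.
Proof.
(* The index types vary with [i], so each inner sum is moved to the tagged union of the [T i], where
   ordinary distributivity applies; [fprod] then leads back to families. *)
under [RHS]eq_bigr => i _ do rewrite (big_tag f i).
rewrite bigA_distr_big_dep /=.
rewrite (reindex (@dffun_of_fprod I T)) /=; last exact/onW_bij/dffun_of_fprod_bij.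
transitivity (\sum_(t : fprod T) \prod_(i in I) (finfun (f i) : {ffun T i -> rat}) (t i)).
  by apply: eq_bigr => t _; apply: eq_bigr => i _; rewrite !ffunE.
rewrite big_fprod; apply: eq_bigr => g _; apply: eq_bigr => i _.
by rewrite /untag; case: eqP => // e; rewrite ffunE.
Qed.

Lemma natr_forall (I : finType) (P : pred I) :
  [forall i, P i]%:R = \prod_i (P i)%:R :> rat.
Proof.
have [/forallP allP|] := boolP [forall i, P i].
  by rewrite big1 // => i _; rewrite allP.
by rewrite negb_forall => /existsP[i /negbTE Pi]; rewrite (bigD1 i) //= Pi mul0r.
Qed.

Lemma dist_eq (V : finType) (e : rel V) (u v : V) (p : seq V) :
  path e u p -> last u p = v ->
  (forall s, path e u s -> last u s = v -> (size p <= size s)%N) ->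
  dist e u v = size p.
Proof.
move=> pth lst mn; apply/eqP; rewrite eqn_leq -{1}lst dist_le //=.
have [|s s_pth [s_last <-]] := @dist_attained _ e u v; last exact: mn.
by apply/connectP; exists p.
Qed.

Lemma mem_zero_divisorsPn (A : finPzRingType) (x : A) :
  reflect (forall y, x * y = 0 \/ y * x = 0 -> y = 0) (x \notin zero_divisors A).
Proof.
rewrite inE negb_exists; apply: (iffP forallP) => [h y xy0|h y].
  have := h y; rewrite negb_and negbK => /orP[/eqP //|/norP[]].
  by case: xy0 => ->; rewrite eqxx.
apply/negP=> /andP[/eqP y0 xy0]; apply: y0; apply: h.
by case/orP: xy0 => /eqP; [left | right].
Qed.

Arguments mem_zero_divisorsPn {A x}.

Lemma mem_zero_divisors (A : finPzRingType) (x y : A) :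
  y != 0 -> x * y = 0 \/ y * x = 0 -> x \in zero_divisors A.
Proof.
move=> y0 h; rewrite inE; apply/existsP; exists y; rewrite y0 /=.
by case: h => ->; rewrite eqxx ?orbT.
Qed.

(** * Distances in the zero-divisor graph of a finite product of rings *)

Section ProductZeroDivisorGraph.
Variables (I : finType) (R : I -> finPzRingType).
Hypothesis I_gt0 : (0 < #|I|)%N.
Hypothesis R_nontriv : forall i, (1 : R i) != 0.
(** In a matrix ring [c] is an outer product of kernel vectors. The case [a = b] gives every
    zero-divisor a two-sided annihilator. *)
Hypothesis joint_annihilator : forall i (a b : R i),
  a \in zero_divisors (R i) -> b \in zero_divisors (R i) ->
  exists2 c, c != 0 & a * c = 0 /\ c * b = 0.

Let P := prod_ring R.
Let zd i := zero_divisors (R i).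

Lemma zero_zd i : (0 : R i) \in zd i.
Proof. by apply: (mem_zero_divisors (R_nontriv i)); left; rewrite mul0r. Qed.

Lemma prod_eq0 (x : P) : (x == 0) = [forall i, x i == 0].
Proof.
apply/eqP/forallP => [-> i|h]; first by rewrite ffunE.
by apply/ffunP=> i; rewrite [RHS]ffunE; apply/eqP.
Qed.

Lemma prod_mulE (x y : P) i : (x * y) i = x i * y i.
Proof. exact: ffunE. Qed.

Definition single i (c : R i) : P := [ffun j => dfwith (fun k => 0 : R k) c j].

Lemma single_in i (c : R i) : single c i = c.
Proof. by rewrite ffunE dfwith_in. Qed.

Lemma single_out i (c : R i) j : i != j -> single c j = 0.
Proof. by move=> ij; rewrite ffunE dfwith_out. Qed.

Lemma single_eq0 i (c : R i) : (single c == 0) = (c == 0).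
Proof.
apply/eqP/eqP => [/(congr1 (fun x : P => x i))|->].
  by rewrite single_in => ->; rewrite ffunE.
apply/ffunP=> j; rewrite [RHS]ffunE.
by have [<-|ij] := eqVneq i j; rewrite ?single_in ?single_out.
Qed.

Lemma mul_single i (x : P) (c : R i) : x * single c = single (x i * c).
Proof.
apply/ffunP=> j; rewrite prod_mulE.
by have [<-|ij] := eqVneq i j; rewrite ?single_in // !single_out ?mulr0.
Qed.

Lemma single_mul i (x : P) (c : R i) : single c * x = single (c * x i).
Proof.
apply/ffunP=> j; rewrite prod_mulE.
by have [<-|ij] := eqVneq i j; rewrite ?single_in // !single_out ?mul0r.
Qed.

(** A nonzero component of an annihilator of [x] shows a singular component of [x]; conversely the
    annihilator of one component is extended by zero. *)
Lemma zero_divisors_prod (x : P) :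
  (x \in zero_divisors P) = [exists i, x i \in zd i].
Proof.
apply/idP/existsP => [|[i xi]].
  rewrite inE => /existsP[y /andP[]]; rewrite prod_eq0 negb_forall.
  case/existsP=> i yi xy; exists i; apply: (mem_zero_divisors yi).
  by case/orP: xy => /eqP h; [left|right]; rewrite -prod_mulE h ffunE.
have [c c0 [xc _]] := joint_annihilator xi xi.
apply: (@mem_zero_divisors _ _ (single c)); first by rewrite single_eq0.
by left; rewrite mul_single xc; apply/eqP; rewrite single_eq0.
Qed.

Lemma zero_zd_prod : 0 \in zero_divisors P.
Proof.
have [i _] : exists i : I, i \in I by apply/card_gt0P.
by rewrite zero_divisors_prod; apply/existsP; exists i; rewrite ffunE zero_zd.
Qed.

Definition adj (A : finPzRingType) (x y : A) := (x * y == 0) || (y * x == 0).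

(** Defined on the whole ring and not only on vertices, so that its count factors over the
    components. Regular elements are opposed to everything, and [0] only to regular elements. *)
Definition opposed (x y : P) :=
  [forall i, ~~ ((x i \in zd i) && (y i \in zd i))].

(** Adjacency is tested before [opposed] because opposed elements may be adjacent, as [(1, 0)] and
    [(0, 1)] are. *)
Definition zd_dist (x y : P) : nat :=
  if x == y then 0%N else if adj x y then 1%N
  else if opposed x y then 3%N else 2%N.

Lemma dist_zd_edge (u v : zd_vertex P) :
  dist (@zd_edge P) u v = zd_dist (val u) (val v).
Proof.
have edge (a b : zd_vertex P) : a != b -> adj (val a) (val b) -> zd_edge a b.
  by move=> ab adj_ab; apply/andP.
rewrite /zd_dist val_eqE; have [->|uv] := eqVneq u v; first exact: (@dist_eq _ _ v v [::]).
have ge1 s : path (@zd_edge P) u s -> last u s = v -> (0 < size s)%N.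
  by case: s => //= _ E; rewrite E eqxx in uv.
case: ifPn => [auv|nauv].
  by apply: (@dist_eq _ _ u v [:: v]) => //=; rewrite andbT; apply: edge.
have ge2 s : path (@zd_edge P) u s -> last u s = v -> (1 < size s)%N.
  case: s => [|w [|//]] /=; first by move=> _ E; rewrite E eqxx in uv.
  by rewrite andbT => /andP[_ h] E; case/negP: nauv; rewrite -E.
have vtx i (c : R i) (y : zd_vertex P) : c != 0 -> adj (single c) (val y) ->
    exists w : zd_vertex P, val w = single c.
  move=> c0 cy; have cD : single c \in zero_divisors P :\ 0.
    rewrite 2!inE single_eq0 c0 /=; have := valP y; rewrite 2!inE => /andP[y0 _].
    by apply: (mem_zero_divisors y0); case/orP: cy => /eqP; [left|right].
  by exists (Sub (single c) cD).
have vtx_zd (w : zd_vertex P) : exists i, val w i \in zd i.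
  by apply/existsP; rewrite -zero_divisors_prod; have := valP w; rewrite 2!inE => /andP[].
have [/forallP opp|] := boolP (opposed _ _); last first.
  rewrite negb_forall => /existsP[i]; rewrite negbK => /andP[ui vi].
  have [c c0 [uc cv]] := joint_annihilator ui vi.
  have [|w def_w] := vtx i c u c0.
    by rewrite /adj mul_single uc single_eq0 eqxx orbT.
  have uw0 : val u * val w = 0 by rewrite def_w mul_single uc; apply/eqP;
    rewrite single_eq0.
  have wv0 : val w * val v = 0 by rewrite def_w single_mul cv; apply/eqP;
    rewrite single_eq0.
  apply: (@dist_eq _ _ u v [:: w; v]) => //=.
  rewrite andbT; apply/andP; split; apply: edge.
  - by apply: contraNneq nauv => ->; rewrite /adj wv0 eqxx.
  - by rewrite /adj uw0 eqxx.
  - by apply: contraNneq nauv => <-; rewrite /adj uw0 eqxx.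
  - by rewrite /adj wv0 eqxx.
(* Opposed vertices are singular at different components [i] and [j]. Annihilators placed there give
   the path [u, w, z, v], with [w z = 0] because the supports are disjoint. *)
have [i ui] := vtx_zd u; have [j vj] := vtx_zd v.
have ij : i != j by apply: contraTneq ui => ->; have := opp j; rewrite vj andbT.
have [c c0 [uc cu]] := joint_annihilator ui ui.
have [d d0 [vd dv]] := joint_annihilator vj vj.
have [|w def_w] := vtx i c u c0.
  by rewrite /adj mul_single uc single_eq0 eqxx orbT.
have [|z def_z] := vtx j d v d0.
  by rewrite /adj single_mul dv single_eq0 eqxx.
apply: (@dist_eq _ _ u v [:: w; z; v]) => //=.
  rewrite andbT; apply/and3P; split; apply: edge.
  (* If [u] were [w], its component [j] would be the zero-divisor [0], against opposedness at
     [j]. *)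
  - apply: contraTneq vj => uw; have := opp j.
    by rewrite uw def_w single_out // zero_zd.
  - by rewrite /adj def_w mul_single uc single_eq0 eqxx.
  - apply: contraNneq c0 => /(congr1 val); rewrite def_w def_z.
    move=> /(congr1 (fun x : P => x i)).
    by rewrite single_in single_out 1?eq_sym // => ->.
  - by rewrite /adj def_w def_z mul_single single_out // mul0r single_eq0 eqxx.
  - apply: contraTneq ui => vz; have := opp i.
    by rewrite -vz def_z single_out 1?eq_sym // zero_zd andbT.
  - by rewrite /adj def_z single_mul dv single_eq0 eqxx.
(* On a walk of length 2, a nonzero component of the middle vertex would make [u] and [v] singular
   at the same place. *)
move=> s pth lst; have := ge2 s pth lst; case: s pth lst => [|a [|b [|//]]] //=.
rewrite andbT => /andP[/andP[_ ua] /andP[_ ab]] b_v _; rewrite b_v {b b_v} in ab.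
have [k ak] : exists k, val a k != 0.
  apply/existsP; rewrite -negb_forall -prod_eq0.
  by have := valP a; rewrite 2!inE => /andP[].
case/negP: (opp k); apply/andP; split; apply: (mem_zero_divisors ak).
  by case/orP: ua => /eqP h; [left|right]; rewrite -prod_mulE h ffunE.
by case/orP: ab => /eqP h; [right|left]; rewrite -prod_mulE h ffunE.
Qed.

(** Adjacency alone is a disjunction of two global equations and does not split over components. For
    opposed elements one entry of each component is regular, which forces the other to be [0]. *)
Lemma opposed_adj (x y : P) :
  opposed x y && adj x y
    = [forall i, ((x i \notin zd i) && (y i == 0))
        || ((x i == 0) && (y i \notin zd i))].
Proof.
apply/andP/forallP => [[/forallP opp xy] i|h].
  have xyi : x i * y i = 0 \/ y i * x i = 0.
    by case/orP: xy => /eqP h; [left|right]; rewrite -prod_mulE h ffunE.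
  have := opp i; rewrite negb_and.
  case: (boolP (x i \in zd i)) => /= [_ yi|xi _]; last first.
    by rewrite (mem_zero_divisorsPn xi _ xyi) eqxx.
  rewrite yi andbT; apply/eqP; apply: (mem_zero_divisorsPn yi).
  by case: xyi; [right|left].
split; [apply/forallP=> i|apply/orP; left; rewrite prod_eq0; apply/forallP=> i].
  by rewrite negb_and; case/orP: (h i) => /andP[xi yi]; rewrite ?xi ?yi ?orbT.
by rewrite prod_mulE; case/orP: (h i) => [/andP[_ /eqP->]|/andP[/eqP-> _]];
  rewrite ?mulr0 ?mul0r.
Qed.

Lemma adj_zd (x y : P) :
  adj x y -> x != 0 -> y != 0 -> (x \in zero_divisors P) && (y \in zero_divisors P).
Proof.
move=> xy x0 y0; apply/andP; split.
  by apply: (mem_zero_divisors y0); case/orP: xy => /eqP; [left|right].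
by apply: (mem_zero_divisors x0); case/orP: xy => /eqP; [right|left].
Qed.

(* The factors 1 make every term that is not a joint indicator a product of a
   function of x and a function of y, so that its double sum separates. *)
Lemma zd_dist_indicators (x y : P) (Z := zero_divisors P) :
  (x \in Z :\ 0)%:R * (y \in Z :\ 0)%:R * (zd_dist x y)%:R
  = 2 * ((x \in Z :\ 0)%:R * (y \in Z :\ 0)%:R)
    - 2 * ((x \in Z :\ 0)%:R * (x == y)%:R)
    - (adj x y)%:R + (x == 0)%:R * 1 + 1 * (y == 0)%:R
    - (x == 0)%:R * (y == 0)%:R + (x \in square_zero P)%:R * (x == y)%:R
    + (opposed x y)%:R - (x \notin Z)%:R * 1 - 1 * (y \notin Z)%:R
    + (x \notin Z)%:R * (y \notin Z)%:R - (opposed x y && adj x y)%:R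
    + (x \notin Z)%:R * (y == 0)%:R + (x == 0)%:R * (y \notin Z)%:R :> rat.
Proof.
rewrite {}/Z /zd_dist; have adj_xy := @adj_zd x y.
have zx : x == 0 -> adj x y by move/eqP->; rewrite /adj mul0r eqxx.
have zy : y == 0 -> adj x y by move/eqP->; rewrite /adj mulr0 eqxx.
have zd0 : 0 \in zero_divisors P := zero_zd_prod.
have zdx : x == 0 -> x \in zero_divisors P by move/eqP->.
have zdy : y == 0 -> y \in zero_divisors P by move/eqP->.
have regx : x \notin zero_divisors P -> opposed x y.
  rewrite zero_divisors_prod negb_exists => /forallP rx.
  by apply/forallP=> i; rewrite negb_and rx.
have regy : y \notin zero_divisors P -> opposed x y.
  rewrite zero_divisors_prod negb_exists => /forallP ry.
  by apply/forallP=> i; rewrite negb_and ry orbT.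
have oppx : opposed x y -> x == 0 -> y \notin zero_divisors P.
  move=> /forallP opp /eqP x0; rewrite zero_divisors_prod negb_exists.
  by apply/forallP=> i; have := opp i; rewrite x0 ffunE zero_zd.
have oppy : opposed x y -> y == 0 -> x \notin zero_divisors P.
  move=> /forallP opp /eqP y0; rewrite zero_divisors_prod negb_exists.
  by apply/forallP=> i; have := opp i; rewrite y0 ffunE zero_zd andbT.
have sq : x == y -> (x \in square_zero P) = (x != 0) && adj x y.
  by move=> /eqP <-; rewrite inE /adj orbb expr2.
have oppe : x == y -> opposed x y -> x \notin zero_divisors P.
  move=> /eqP <- /forallP opp; rewrite zero_divisors_prod negb_exists.
  by apply/forallP=> i; have := opp i; rewrite andbb.
have eq0 : x == y -> (x == 0) = (y == 0) by move/eqP->.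
have eqz : x == y -> (x \in zero_divisors P) = (y \in zero_divisors P) by move/eqP->.
rewrite !in_setD1.
(* A truth table in eight booleans: [ring] closes rows where the identity holds, and every other row
   contradicts one of the thirteen facts. *)
move: adj_xy zx zy zdx zdy regx regy oppx oppy sq oppe eq0 eqz.
case: (x == y); case: (x == 0); case: (y == 0); case: (adj x y);
case: (opposed x y); case: (x \in zero_divisors P);
case: (y \in zero_divisors P); case: (x \in square_zero P);
  move=> /=; do ?[by move=> *; ring];
  do ?by move=> h1 h2 h3 h4 h5 h6 h7 h8 h9 h10 h11 h12 h13;
  first [ by have := h1 isT isT isT | by have := h2 isT | by have := h3 isT
        | by have := h4 isT | by have := h5 isT | by have := h6 isT
        | by have := h7 isT | by have := h8 isT isT | by have := h9 isT isT
        | by have := h10 isT | by have := h11 isT isT | by have := h12 isT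
        | by have := h13 isT ].
Qed.

Lemma sum_eq_op (T : finType) (x : T) : \sum_y (x == y)%:R = 1 :> rat.
Proof. by rewrite (bigD1 x) //= eqxx big1 ?addr0 // => y /negbTE; rewrite eq_sym => ->. Qed.

Lemma wiener_index_count :
  let d : rat := #|zero_divisors P :\ 0|%:R in
  let r : rat := #|{: P}|%:R in
  let u : rat := #|[set x : P | x \notin zero_divisors P]|%:R in
  2 * wiener_index (@zd_edge P) =
    2 * d ^+ 2 - 2 * d - (\sum_(x : P) \sum_(y : P) (adj x y)%:R)
    + 2 * r - 1 + #|square_zero P|%:R
    + \sum_(x : P) \sum_(y : P) (opposed x y)%:R
    - 2 * r * u + u ^+ 2
    - \sum_(x : P) \sum_(y : P) (opposed x y && adj x y)%:R + 2 * u.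
Proof.
move=> d r u.
have sd : \sum_(x : P) (x \in zero_divisors P :\ 0)%:R = d.
  apply: etrans (esym (card_set_sum _)) _.
  by rewrite /d; congr (_%:R); apply: eq_card => x; rewrite inE.
have sN : \sum_(x : P) (x \in square_zero P)%:R = #|square_zero P|%:R :> rat.
  apply: etrans (esym (card_set_sum _)) _.
  by congr (_%:R); apply: eq_card => x; rewrite inE.
have su : \sum_(x : P) (x \notin zero_divisors P)%:R = u.
  exact: esym (card_set_sum _).
have s1 : \sum_(x : P) 1 = r by rewrite sumr_const.
have s0 : \sum_(x : P) (x == 0)%:R = 1 :> rat.
  by apply: etrans (sum_eq_op (0 : P)); apply: eq_bigr => x _; rewrite eq_sym.
have sep (f g : P -> rat) : \sum_x \sum_y f x * g y = (\sum_x f x) * \sum_y g y.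
  by rewrite big_distrlr.
have diag (f : P -> rat) : \sum_(x : P) \sum_(y : P) f x * (x == y)%:R = \sum_x f x.
  by apply: eq_bigr => x _; rewrite -mulr_sumr sum_eq_op mulr1.
rewrite /wiener_index mulVKf //.
(* Sums over the vertex type become indicator-weighted sums over the whole ring, ready for
   [zd_dist_indicators]. *)
transitivity (\sum_(x : P) \sum_(y : P) ((x \in zero_divisors P :\ 0)%:R
    * (y \in zero_divisors P :\ 0)%:R * (zd_dist x y)%:R) : rat).
  under eq_bigr => a _ do under eq_bigr => b _ do rewrite dist_zd_edge.
  rewrite -(big_sub (zero_divisors P :\ 0) (fun x =>
    \sum_(v : zd_vertex P) (zd_dist x (val v))%:R)) big_mkcond /=.
  apply: eq_bigr => x _.
  rewrite -(big_sub (zero_divisors P :\ 0) (fun y => (zd_dist x y)%:R)).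
  rewrite big_mkcond /=.
  case: (x \in _); last by rewrite big1 // => y _; rewrite !mul0r.
  by apply: eq_bigr => y _; case: (y \in _); rewrite ?mulr0 ?mul0r ?mul1r.
under eq_bigr => x _ do under eq_bigr => y _ do rewrite zd_dist_indicators.
under eq_bigr => x _ do
  rewrite !(big_split, sumrN) /= -!mulr_sumr sd s0 su s1 sum_eq_op.
rewrite !(big_split, sumrN) /= -!mulr_suml -!mulr_sumr -!mulr_suml sd s0 su s1 sN.
by ring.
Qed.

(** * Pair counts as products over the components *)

Lemma sum_forall (p : forall i, pred (R i)) :
  \sum_(x : P) [forall i, p i (x i)]%:R = \prod_i #|[set a | p i a]|%:R :> rat.
Proof.
under [LHS]eq_bigr => x _ do rewrite natr_forall.
apply: etrans (sum_prod_dffun (fun i a => (p i a)%:R)) _.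
by apply: eq_bigr => i _; rewrite card_set_sum.
Qed.

Lemma sum_forall2 (p : forall i, rel (R i)) :
  \sum_(x : P) \sum_(y : P) [forall i, p i (x i) (y i)]%:R
    = \prod_i \sum_a #|[set b | p i a b]|%:R :> rat.
Proof.
under [LHS]eq_bigr => x _ do rewrite (sum_forall (fun i => p i (x i))).
exact: (sum_prod_dffun (fun i a => #|[set b | p i a b]|%:R)).
Qed.

Let r i : rat := #|R i|%:R.
Let u i : rat := #|[set a | a \notin zd i]|%:R.

Lemma card_zdC i : #|zd i|%:R = r i - u i.
Proof.
apply/eqP; rewrite eq_sym subr_eq -natrD; apply/eqP; congr (_%:R).
by rewrite -(cardsC (zd i)).
Qed.

Lemma card_prod_ring : #|{: P}|%:R = \prod_i r i.
Proof.
rewrite -cardsT; have -> : [set: P] = [set x : P | [forall i : I, true]].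
  by apply/setP=> x; rewrite !inE; symmetry; apply/forallP.
rewrite card_set_sum (sum_forall (fun i _ => true)); apply: eq_bigr => i _.
by rewrite /r -cardsT; congr (_%:R); apply: eq_card => a; rewrite !inE.
Qed.

Lemma card_regular : #|[set x : P | x \notin zero_divisors P]|%:R = \prod_i u i.
Proof.
rewrite -(sum_forall (fun i a => a \notin zd i)) card_set_sum.
by apply: eq_bigr => x _; rewrite zero_divisors_prod negb_exists.
Qed.

Lemma card_zero_divisors_prod :
  #|zero_divisors P|%:R = \prod_i r i - \prod_i u i.
Proof.
apply/eqP; rewrite eq_sym subr_eq -card_prod_ring -card_regular -natrD; apply/eqP.
by rewrite -(cardsC (zero_divisors P)).
Qed.

Lemma card_square_zero_prod :
  #|square_zero P|%:R = \prod_i #|[set a : R i | a * a == 0]|%:R - 1 :> rat.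
Proof.
rewrite -(sum_forall (fun i a => a * a == 0)).
apply/eqP; rewrite eq_sym subr_eq natr1; apply/eqP.
transitivity (#|[set x : P | x * x == 0]|%:R : rat).
  rewrite card_set_sum; apply: eq_bigr => x _; rewrite prod_eq0.
  by congr (_%:R : rat); congr nat_of_bool; apply: eq_forallb => i; rewrite prod_mulE.
congr (_%:R); rewrite (cardsD1 0) inE mul0r eqxx add1n; congr _.+1.
by apply: eq_card => x; rewrite !inE expr2.
Qed.

(** At each component the excluded pairs consist of two zero-divisors, leaving
    [r i ^+ 2 - (r i - u i) ^+ 2] pairs. *)
Lemma sum_opposed :
  \sum_(x : P) \sum_(y : P) (opposed x y)%:R = \prod_i (u i * (2 * r i - u i)).
Proof.
rewrite (sum_forall2 (fun i a b => ~~ ((a \in zd i) && (b \in zd i)))).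
apply: eq_bigr => i _.
have -> : u i * (2 * r i - u i) = r i * r i - (r i - u i) * (r i - u i) by ring.
rewrite -card_zdC.
transitivity (\sum_(a : R i) (r i - (a \in zd i)%:R * #|zd i|%:R)).
  apply: eq_bigr => a _; case: (a \in zd i); rewrite /= ?mul0r ?mul1r.
    by rewrite card_zdC opprB addrC subrK.
  by rewrite subr0 /r -cardsT; congr (_%:R); apply: eq_card => b; rewrite !inE.
rewrite sumrB -mulr_suml sumr_const -[r i *+ _]mulr_natr; congr (_ - _ * _).
apply: etrans (esym (card_set_sum _)) _.
by congr (_%:R); apply: eq_card => a; rewrite inE.
Qed.

(** By [opposed_adj] each component pairs a regular element with [0], in one of two orders. The
    orders exclude each other since [0] is a zero-divisor, so a component contributes [2 * u i]. *)
Lemma sum_opposed_adj :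
  \sum_(x : P) \sum_(y : P) (opposed x y && adj x y)%:R = 2 ^+ #|I| * \prod_i u i.
Proof.
under [LHS]eq_bigr => x _ do under eq_bigr => y _ do rewrite opposed_adj.
rewrite (sum_forall2 (fun i a b =>
  ((a \notin zd i) && (b == 0)) || ((a == 0) && (b \notin zd i)))).
rewrite -prodr_const -big_split; apply: eq_bigr => i _ /=.
transitivity (\sum_(a : R i) ((a \notin zd i)%:R + (0 == a)%:R * u i)).
  apply: eq_bigr => a _; rewrite (eq_sym 0).
  have [->|a0] := eqVneq a 0.
    by rewrite zero_zd /= add0r mul1r.
  rewrite mul0r addr0; case: (boolP (a \in zd i)) => _ /=.
    by rewrite (_ : [set _ | _] = set0) ?cards0 //; apply/setP=> b; rewrite !inE.
  rewrite (_ : [set _ | _] = [set 0]) ?cards1 //.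
  by apply/setP=> b; rewrite !inE orbF.
rewrite big_split /= -mulr_suml sum_eq_op mulrDl mul1r; congr (_ + _).
exact: esym (card_set_sum _).
Qed.

(** Inclusion-exclusion on the two orders of multiplication; exchanging [x] and [y] shows that both
    orders have the same count. *)
Lemma sum_adj :
  \sum_(x : P) \sum_(y : P) (adj x y)%:R
    = 2 * \prod_i \sum_a #|[set b : R i | a * b == 0]|%:R
      - \prod_i \sum_a #|[set b : R i | (a * b == 0) && (b * a == 0)]|%:R :> rat.
Proof.
rewrite -(sum_forall2 (fun i a b => (a * b == 0) && (b * a == 0))).
rewrite -(sum_forall2 (fun i a b => a * b == 0)).
have mul0E (x y : P) : (x * y == 0) = [forall i, x i * y i == 0].
  by rewrite prod_eq0; apply: eq_forallb => i; rewrite prod_mulE.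
transitivity (\sum_(x : P) \sum_(y : P) ((x * y == 0)%:R + (y * x == 0)%:R
    - ((x * y == 0) && (y * x == 0))%:R) : rat).
  apply: eq_bigr => x _; apply: eq_bigr => y _; rewrite /adj.
  by case: (x * y == 0); case: (y * x == 0); rewrite /= ?subr0 ?addr0 ?add0r ?addrK ?subrr.
under eq_bigr => x _ do rewrite sumrB big_split /=.
rewrite sumrB big_split /= mulr2n mulrDl mul1r; congr (_ + _ - _).
- by apply: eq_bigr => x _; apply: eq_bigr => y _; rewrite mul0E.
- rewrite exchange_big; apply: eq_bigr => x _; apply: eq_bigr => y _; rewrite mul0E //.
apply: eq_bigr => x _; apply: eq_bigr => y _; rewrite !mul0E.
congr (_%:R); congr nat_of_bool; apply/andP/forallP => [[/forallP h1 /forallP h2] i|h].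
  by rewrite h1 h2.
by split; apply/forallP=> i; case/andP: (h i).
Qed.

Lemma wiener_index_prod :
  let Z : rat := #|zero_divisors P|%:R in
  2 * wiener_index (@zd_edge P) =
    2 * Z ^+ 2 - 6 * Z + 3
    - (2 * \prod_i \sum_a #|[set b : R i | a * b == 0]|%:R
       - \prod_i \sum_a #|[set b : R i | (a * b == 0) && (b * a == 0)]|%:R)
    + 2 * \prod_i r i + #|square_zero P|%:R
    + \prod_i (u i * (2 * r i - u i)) - 2 * \prod_i r i * \prod_i u i
    + (\prod_i u i) ^+ 2 - 2 ^+ #|I| * \prod_i u i + 2 * \prod_i u i.
Proof.
move=> Z; rewrite wiener_index_count card_regular card_prod_ring.
rewrite sum_opposed sum_opposed_adj sum_adj.
(* [0] is a zero-divisor but not a vertex. *)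
have -> : #|zero_divisors P :\ 0|%:R = Z - 1.
  by rewrite /Z [in RHS](cardsD1 0) zero_zd_prod natrD [1 + _]addrC addrK.
by ring.
Qed.

End ProductZeroDivisorGraph.

(** * Matrix rings as components *)

Lemma joint_annihilator_mx (F : fieldType) n (A B : 'M[F]_n) :
  A \notin unitmx -> B \notin unitmx ->
  exists2 C : 'M_n, C != 0 & A *m C = 0 /\ C *m B = 0.
Proof.
rewrite !unitmxE !unitfE !negbK -(det_tr A) => /det0P[w w0 wA] /det0P[v v0 vB].
(* [A *m w^T = 0] and [v *m B = 0]; the outer product is nonzero because its entries are the
   products of entries of [w] and [v]. *)
exists (w^T *m v); last first.
  by rewrite -mulmxA vB mulmx0 mulmxA -[A]trmxK -trmx_mul wA trmx0 mul0mx.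
have [i wi] := rV0Pn _ w0; have [j vj] := rV0Pn _ v0.
apply/eqP=> /matrixP/(_ i j)/eqP; rewrite !mxE big_ord1 mxE mulf_eq0.
by rewrite (negbTE wi) (negbTE vj).
Qed.

Lemma zero_divisors_mx (F : finFieldType) n (A : 'M[F]_n) :
  (A \in zero_divisors (mx_ring F n)) = (A \notin unitmx).
Proof.
apply/idP/idP => [|nU].
  apply: contraL => UA; apply/mem_zero_divisorsPn => B [] /= AB.
    by rewrite -[B](mulKmx UA) (AB : A *m B = 0) mulmx0.
  by rewrite -[B](mulmxK UA) (AB : B *m A = 0) mul0mx.
have [C C0 [AC _]] := joint_annihilator_mx nU nU.
by apply: (@mem_zero_divisors (mx_ring F n) A C C0); left.
Qed.

(** Pulling [q ^+ j] out of [q ^+ n - q ^+ j] leaves [q ^+ (n - j) - 1]; the extracted exponents add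
    up to ['C(n, 2)], and the remaining factors appear in reverse order. *)
Lemma gl_prodE (q n : nat) :
  gl_prod q n = \prod_(0 <= j < n) (q%:R ^+ n - q%:R ^+ j).
Proof.
rewrite /gl_prod -bin2_sum -prodrXr big_add1 /= [X in _ * X]big_nat_rev -big_split /=.
apply: eq_big_nat => j /andP[_ jn].
by rewrite mulrBr mulr1 -exprD add0n subnSK // subnKC // ltnW.
Qed.

Lemma card_mx_ring (F : finFieldType) n : #|mx_ring F n|%:R = #|F|%:R ^+ (n ^ 2) :> rat.
Proof. by rewrite -natrX -mulnn -card_mx. Qed.

Lemma card_regular_mx (F : finFieldType) n :
  #|[set A | A \notin zero_divisors (mx_ring F n)]|%:R = gl_prod #|F| n.
Proof.
have := card_row_free_sub n (1%:M : 'M[F]_n); rewrite mxrank1 gl_prodE => <-.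
congr (_%:R); apply: eq_card => A; rewrite !inE submx1 andbT row_free_unit.
by have := zero_divisors_mx A; rewrite inE => ->; rewrite negbK.
Qed.

Lemma sum_mxrank (F : finFieldType) n (g : nat -> rat) :
  \sum_(A : 'M[F]_n) g (\rank A)
    = \sum_(k < n.+1) #|[set A : 'M[F]_n | \rank A == k]|%:R * g k.
Proof.
rewrite (partition_big (fun A : 'M[F]_n => inord (\rank A) : 'I_n.+1) xpredT) //=.
apply: eq_bigr => k _; rewrite -sum1dep_card natr_sum mulr_suml.
apply: eq_big => A; first by rewrite -val_eqE /= inordK // ltnS rank_leq_row.
by move=> /eqP <-; rewrite mul1r inordK // ltnS rank_leq_row.
Qed.

Lemma sum_card_rann (F : finFieldType) n (q := #|F|%:R : rat) :
  \sum_(A : mx_ring F n) #|[set B | A * B == 0]|%:R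
    = \sum_(k < n.+1) (\prod_(0 <= j < k) ((q ^+ n - q ^+ j) ^+ 2 / (q ^+ k - q ^+ j)))
        * q ^+ ((n - k) ^ 2) * q ^+ (k * (n - k)).
Proof.
transitivity (\sum_(A : 'M[F]_n) q ^+ (n * (n - \rank A))).
  by apply: eq_bigr => A _; exact: card_rann.
rewrite (@sum_mxrank F n (fun k => q ^+ (n * (n - k)))); apply: eq_bigr => k _.
(* The exponent [n (n - k)] splits as [(n - k) ^ 2 + k (n - k)]. *)
rewrite card_rank -mulrA -exprD -mulnn -mulnDl subnK; last by rewrite -ltnS.
by congr (_ * _); apply: eq_bigr => j _; rewrite expr2.
Qed.

Lemma sum_card_lrann (F : finFieldType) n (q := #|F|%:R : rat) :
  \sum_(A : mx_ring F n) #|[set B | (A * B == 0) && (B * A == 0)]|%:R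
    = \sum_(k < n.+1) (\prod_(0 <= j < k) ((q ^+ n - q ^+ j) ^+ 2 / (q ^+ k - q ^+ j)))
        * q ^+ ((n - k) ^ 2).
Proof.
transitivity (\sum_(A : 'M[F]_n) q ^+ ((n - \rank A) ^ 2)).
  by apply: eq_bigr => A _; exact: card_lrann.
rewrite (@sum_mxrank F n (fun k => q ^+ ((n - k) ^ 2))); apply: eq_bigr => k _.
by rewrite card_rank; congr (_ * _); apply: eq_bigr => j _; rewrite expr2.
Qed.

Lemma card_square0 (F : finFieldType) n (q := #|F|%:R : rat) : (0 < n)%N ->
  #|[set A : mx_ring F n | A * A == 0]|%:R
    = \sum_(k < n) (\prod_(0 <= j < 2 * k) (q ^+ n - q ^+ j))
        / (q ^+ (k ^ 2) * \prod_(0 <= j < k) (q ^+ k - q ^+ j)).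
Proof.
move=> n_gt0.
transitivity (\sum_(k < n.+1)
    #|[set A : 'M[F]_n | (\rank A == k) && (A *m A == 0)]|%:R : rat).
  rewrite -sum1dep_card natr_sum.
  rewrite (partition_big (fun A : 'M[F]_n => inord (\rank A) : 'I_n.+1) xpredT) //=.
  apply: eq_bigr => k _; rewrite -sum1dep_card natr_sum; apply: eq_bigl => A.
  by rewrite andbC -val_eqE /= inordK // ltnS rank_leq_row.
rewrite big_ord_recr /= [X in _ + X]card_rank_square0.
(* For [n > 0] the product reaches the zero factor [j = n]: no square-zero matrix has full rank, so
   the sum stops at [n - 1]. *)
rewrite (_ : \prod_(0 <= j < 2 * n) _ = 0) ?mul0r ?addr0; last first.
  rewrite (@big_cat_nat _ _ _ n.+1) //=; last by rewrite mul2n -addnn -addn1 leq_add2l.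
  by rewrite big_nat_recr //= subrr mulr0 mul0r.
by apply: eq_bigr => k _; rewrite card_rank_square0.
Qed.

(** Distributivity evaluates the sum over all subsets: weight [1] gives the product of the [r i],
    and weight [2 ^+ #|L|] that of [2 * (r i - u i) + u i]. It remains to remove the subsets with
    fewer than two elements. *)
Lemma mul_T_sum (l : nat) (n q : 'I_l -> nat)
    (r := fun i => (q i)%:R ^+ (n i ^ 2) : rat) (u := fun i => gl_prod (q i) (n i)) :
  T_sum n q * \prod_i u i
    = \prod_i (u i * (2 * r i - u i)) - 2 * \prod_i r i * \prod_i u i
      + (\prod_i u i) ^+ 2.
Proof.
pose w (L : {set 'I_l}) i := if i \in L then r i - u i else u i.
have sum_w : \sum_(L : {set 'I_l}) \prod_i w L i = \prod_i r i.
  rewrite -(bigA_distr _ _ (fun i => r i - u i) u) /=.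
  by apply: eq_bigr => i _; rewrite subrK.
have sum_2w : \sum_(L : {set 'I_l}) 2 ^+ #|L| * \prod_i w L i = \prod_i (2 * r i - u i).
  transitivity (\prod_i (2 * (r i - u i) + u i)); last first.
    by apply: eq_bigr => i _; ring.
  rewrite (bigA_distr _ _ (fun i => 2 * (r i - u i)) u) /=; apply: eq_bigr => L _.
  rewrite -prodr_const big_mkcond -big_split; apply: eq_bigr => i _ /=.
  by rewrite /w; case: (i \in L); rewrite ?mul1r.
(* The empty set has weight [1 - 2 = -1], and singletons have weight [2 - 2 = 0]. *)
have sum_small : \sum_(L : {set 'I_l} | ~~ (2 <= #|L|)%N) (2 ^+ #|L| - 2) * \prod_i w L i
    = - \prod_i u i.
  rewrite (bigD1 set0) ?cards0 //= [X in _ + X]big1 ?addr0; last first.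
    move=> L /andP[L2 L0]; rewrite (_ : #|L| = 1%N) ?subrr ?mul0r //.
    by apply/eqP; rewrite eqn_leq -ltnS ltnNge L2 card_gt0.
  rewrite (_ : 2 ^+ 0 - 2 = -1) // mulN1r; congr (- _).
  by apply: eq_bigr => i _; rewrite /w inE.
have -> : T_sum n q = \prod_i (2 * r i - u i) - 2 * \prod_i r i + \prod_i u i.
  rewrite -sum_w -sum_2w mulr_sumr -sumrB -[X in _ + X]opprK -sum_small.
  rewrite [X in X - _](bigID (fun L : {set 'I_l} => (2 <= #|L|)%N)) /=.
  under [X in _ + X - _]eq_bigr => L _ do rewrite -mulrBl.
  rewrite addrK; apply: eq_bigr => L _; rewrite -mulrBl //.
by rewrite [X in _ = X - _ + _]big_split /=; ring.
Qed.

(** * Assembly of the formula *)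

Theorem theorem3 (l : nat) (n : 'I_l -> nat) (F : 'I_l -> finFieldType)
    (q : 'I_l -> nat) (l_gt0 : (0 < l)%N) (n_gt0 : forall i, (0 < n i)%N)
    (card_F : forall i, #|F i| = q i) :
  let R := mx_prod_ring n F in
  let Q i : rat := (q i)%:R in
  let Z : rat := #|zero_divisors R|%:R in
  let N2 : rat := #|square_zero R|%:R in
  [/\ wiener_index (@zd_edge R) =
        Z ^+ 2 - 5 / 2 * Z + 3 / 2
        + (T_sum n q / 2 - 2 ^+ (l - 1) + 1) * \prod_i gl_prod (q i) (n i)
        - 1 / 2 *
          (\sum_(k : {dffun forall i : 'I_l, 'I_(n i).+1})
             (\prod_i \prod_(0 <= j < k i)
                ((Q i ^+ n i - Q i ^+ j) ^+ 2 / (Q i ^+ k i - Q i ^+ j)))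
             * (\prod_i Q i ^+ ((n i - k i) ^ 2))
             * (2 * (\prod_i Q i ^+ (k i * (n i - k i))) - 1))
        + 1 / 2 * (\prod_i Q i ^+ (n i ^ 2))
        + 1 / 2 * (\prod_i \prod_(0 <= j < n i) (Q i ^+ n i - Q i ^+ j))
        + 1 / 2 * N2,
      Z = \prod_i Q i ^+ (n i ^ 2) - \prod_i gl_prod (q i) (n i)
    & N2 = (\sum_(k : {dffun forall i : 'I_l, 'I_(n i)})
              \prod_i
                ((\prod_(0 <= j < 2 * k i) (Q i ^+ n i - Q i ^+ j))
                 / (Q i ^+ (k i ^ 2)
                    * \prod_(0 <= j < k i) (Q i ^+ k i - Q i ^+ j))))
           - 1].
Proof.
move=> R Q Z N2.
pose M i := mx_ring (F i) (n i).
have I_gt0 : (0 < #|'I_l|)%N by rewrite card_ord.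
have M_nontriv i : (1 : M i) != 0.
  apply/eqP=> /(congr1 (fun A : 'M[F i]_(n i) => \rank A)).
  by rewrite (mxrank1 (F i) (n i)) mxrank0 => E; have := n_gt0 i; rewrite E.
have joint i (a b : M i) : a \in zero_divisors (M i) -> b \in zero_divisors (M i) ->
    exists2 c, c != 0 & a * c = 0 /\ c * b = 0.
  by rewrite !zero_divisors_mx; apply: joint_annihilator_mx.
have cardM i : #|M i|%:R = Q i ^+ (n i ^ 2) by rewrite card_mx_ring card_F.
have cardU i : #|[set a | a \notin zero_divisors (M i)]|%:R = gl_prod (q i) (n i).
  by rewrite card_regular_mx card_F.
have defZ : Z = \prod_i Q i ^+ (n i ^ 2) - \prod_i gl_prod (q i) (n i).
  rewrite /Z (card_zero_divisors_prod joint).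
  by congr (_ - _); apply: eq_bigr.
split=> //; last first.
  rewrite /N2 card_square_zero_prod; congr (_ - _).
  rewrite (sum_prod_dffun (fun i (k : 'I_(n i)) =>
    (\prod_(0 <= j < 2 * k) (Q i ^+ n i - Q i ^+ j))
     / (Q i ^+ (k ^ 2) * \prod_(0 <= j < k) (Q i ^+ k - Q i ^+ j)))).
  by apply: eq_bigr => i _; rewrite card_square0 // card_F.
(* [a i k] counts pairs of a rank-[k] matrix and a two-sided annihilator of it; [c i k] below counts
   those with a right annihilator. *)
pose a i (k : 'I_(n i).+1) :=
  (\prod_(0 <= j < k) ((Q i ^+ n i - Q i ^+ j) ^+ 2 / (Q i ^+ k - Q i ^+ j)))
    * Q i ^+ ((n i - k) ^ 2).
pose c i (k : 'I_(n i).+1) := a i k * Q i ^+ (k * (n i - k)).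
have sum_k : \sum_(k : {dffun forall i : 'I_l, 'I_(n i).+1})
      (\prod_i \prod_(0 <= j < k i)
         ((Q i ^+ n i - Q i ^+ j) ^+ 2 / (Q i ^+ k i - Q i ^+ j)))
      * (\prod_i Q i ^+ ((n i - k i) ^ 2))
      * (2 * (\prod_i Q i ^+ (k i * (n i - k i))) - 1)
    = 2 * (\prod_i \sum_k c i k) - \prod_i \sum_k a i k.
  rewrite -(sum_prod_dffun c) -(sum_prod_dffun a) mulr_sumr -sumrB.
  by apply: eq_bigr => k _; rewrite -big_split mulrBr mulr1 mulrCA -big_split.
have gl_prodQ : \prod_i \prod_(0 <= j < n i) (Q i ^+ n i - Q i ^+ j)
    = \prod_i gl_prod (q i) (n i).
  by apply: eq_bigr => i _; rewrite gl_prodE.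
have sum_rann i : \sum_x #|[set y : M i | x * y == 0]|%:R = \sum_k c i k.
  by rewrite sum_card_rann card_F.
have sum_lrann i :
    \sum_x #|[set y : M i | (x * y == 0) && (y * x == 0)]|%:R = \sum_k a i k.
  by rewrite sum_card_lrann card_F.
have W := wiener_index_prod I_gt0 M_nontriv joint.
rewrite /= (eq_bigr _ (fun i _ => sum_rann i)) (eq_bigr _ (fun i _ => sum_lrann i)) in W.
rewrite (eq_bigr _ (fun i _ => cardM i)) (eq_bigr _ (fun i _ => cardU i)) in W.
have gl_sum : \prod_i (#|[set x | x \notin zero_divisors (M i)]|%:R
     * (2 * #|M i|%:R - #|[set x | x \notin zero_divisors (M i)]|%:R))
    = \prod_i (gl_prod (q i) (n i) * (2 * Q i ^+ (n i ^ 2) - gl_prod (q i) (n i))).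
  by apply: eq_bigr => i _; rewrite cardM cardU.
have T_sumE : T_sum n q * (\prod_i gl_prod (q i) (n i))
    = \prod_i (gl_prod (q i) (n i) * (2 * Q i ^+ (n i ^ 2) - gl_prod (q i) (n i)))
      - 2 * (\prod_i Q i ^+ (n i ^ 2)) * (\prod_i gl_prod (q i) (n i))
      + (\prod_i gl_prod (q i) (n i)) ^+ 2 := mul_T_sum n q.
(* [l > 0] is what makes the truncated [l - 1] harmless. *)
have two_l : 2 ^+ l = 2 * 2 ^+ (l - 1) :> rat by rewrite -exprS subn1 prednK.
rewrite gl_sum card_ord two_l -/R -/Z -/N2 in W.
(* After doubling, everything is linear in the named products. [defZ] turns [- 6 Z] plus twice the
   ring cardinality into [- 5 Z] plus the numbers of elements and of regular elements. *)
apply: (mulfI (_ : 2 != 0)) => //.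
by rewrite W sum_k gl_prodQ; lra.
Qed.
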